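(* Let $n\in\mathbb N$. Under any tie-breaking rule $\pi$ for the JSQ system in which each buffer has capacity $1\le b\le\infty$, we have $$\tilde Q_{b,+i}^{\mathrm{FSL},n}(t)\le_{st}Q_{+i}^{\pi,n}(t)\le_{st}\tilde Q_{b,+i}^{\mathrm{SSL},n}(t)\qquad\text{for all }t\ge0\text{ and }i\in\mathbb N,$$ where $\le_{st}$ denotes the usual stochastic order.
   Context: **JSQ system.** There are $n$ servers, server $k$ having exponential service rate $\mu_k^n\in[\mu_{\min},\mu_{\max}]$, $0<\mu_{\min}<\mu_{\max}<\infty$, and serving its own buffer of capacity $b$ (counting the job in service) in FCFS order. Jobs arrive according to a Poisson process $A^n$ of rate $n\lambda^n$. Each arriving job is immediately routed to a server with the fewest jobs, ties being broken by $\pi$; if $b<\infty$ and all buffers are full, the job is rejected. $Q_i^{\pi,n}(t)$ is the number of servers with at least $i$ jobs at time $t$ and $Q_{+i}^{\pi,n}=\sum_{j\ge i}Q_j^{\pi,n}$. The initial number of jobs in the system is finite. **JSQ-FSL and JSQ-SSL systems.** These have the same arrival process, the same $n$ servers with rates $\mu_1^n,\dots,\mu_n^n$, and $n$ buffers of capacity $b$; arriving jobs join a shortest buffer (rejected if all are full), but servers and buffers are decoupled: after each arrival or departure, servers are reassigned preemptively to buffers (one server per buffer). In JSQ-FSL (fastest serves the longest), at all times, if $\mu_k^n<\mu_{k'}^n$ then the buffer served by $k$ is no longer than the one served by $k'$. In JSQ-SSL (slowest serves the longest), at all times, if $\mu_k^n<\mu_{k'}^n$ then the buffer served by $k$ is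 at least as long as the one served by $k'$. For $\sigma\in\{\mathrm{FSL},\mathrm{SSL}\}$, $\tilde Q_{b,i}^{\sigma,n}(t)$ is the number of buffers with at least $i$ jobs at time $t$ and $\tilde Q_{b,+i}^{\sigma,n}=\sum_{j\ge i}\tilde Q_{b,j}^{\sigma,n}$. All systems start from the same initial occupancy: $\tilde Q_{b,i}^{\sigma,n}(0)=Q_i^{\pi,n}(0)$ for all $i$. *)

(* Defs.v *)
From HB Require Import structures.
From mathcomp Require Import all_boot all_order all_algebra all_fingroup.
From mathcomp Require Import all_classical all_reals all_analysis.

Set Implicit Arguments.
Unset Strict Implicit.
Unset Printing Implicit Defensive.

Import Order.TTheory GRing.Theory Num.Theory.
Import numFieldNormedType.Exports.

Local Open Scope classical_set_scope.
Local Open Scope ring_scope.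

Section queues.
Context {n : nat}.

Definition queues := {ffun 'I_n -> nat}.

Implicit Types (b : option nat) (x : queues) (k : 'I_n).

(* A buffer capacity is [Some c] with c finite, or [None] for no limit. *)
Definition capacity_ge1 b : bool := if b is Some c then (1 <= c)%N else true.

Definition fits b x : bool :=
  if b is Some c then [forall k, (x k <= c)%N] else true.

Definition all_full b x : bool :=
  if b is Some c then [forall k, (c <= x k)%N] else false.

Definition shortest x k : bool := [forall k', (x k <= x k')%N].

Definition add_job x k : queues := [ffun j => (x j + (j == k))%N].

(* The subtraction is truncated: nothing happens if buffer k is empty. *)
Definition remove_job x k : queues := [ffun j => (x j - (j == k))%N].

(* x' is the state after a job arriving in state x has been sent to buffer k. *)
Definition arrival b x k x' : Prop :=
  if all_full b x then x' = x else shortest x k /\ x' = add_job x k.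

(* Q_i *)
Definition occupancy x (i : nat) : nat := #|[set k | (i <= x k)%N]%SET|.

(* Q_{+i} *)
Definition tail_occupancy {R : realType} x (i : nat) : \bar R :=
  (\sum_(i <= j <oo) (occupancy x j)%:R%:E)%E.

End queues.
Arguments queues n : clear implicits.

Section paths.
Context {R : realType}.

(* Time is [0, +oo[; paths are functions on R whose values at negative times
   are irrelevant. The values of a path are discrete, so "l is the left limit
   at t" means "equal to l just before t". *)
Definition left_limit {T : Type} (f : R -> T) (t : R) (l : T) : Prop :=
  \forall s \near t^'-, f s = l.

Definition step_path {T : Type} (f : R -> T) : Prop :=
  (forall t, 0 <= t -> \forall s \near t^'+, f s = f t) /\
  (forall t, 0 < t -> exists l, left_limit f t l).

Definition jumps (N : R -> nat) (t : R) : Prop :=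
  exists m, left_limit N t m /\ N t = m.+1.

Definition counting_path (N : R -> nat) : Prop :=
  [/\ N 0 = 0%N, step_path N &
      forall t, 0 < t -> jumps N t \/ left_limit N t (N t)].

Definition only_jump {I : Type} (N : I -> R -> nat) (c : I) (t : R) : Prop :=
  jumps (N c) t /\ forall c', jumps (N c') t -> c' = c.

Context {n : nat}.

(* The clock [None] is the arrival process, the clock [Some k] rings at the
   potential service completions of server k. *)
Definition clocks {T : Type} (A : T) (S : 'I_n -> T) (c : option 'I_n) : T :=
  if c is Some k then S k else A.

(* Server k serves buffer k; a job arriving at time t goes to the server pi t.
   Several clocks ringing simultaneously is a null event, for which nothing is
   prescribed. *)
Definition jsq_path (b : option nat) (N : option 'I_n -> R -> nat)
    (pi : R -> 'I_n) (X : R -> queues n) : Prop :=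
  [/\ step_path X, (forall t, 0 <= t -> fits b (X t)) &
  forall t x, 0 < t -> left_limit X t x ->
  [/\ (forall c, ~ jumps (N c) t) -> X t = x,
      only_jump N None t -> arrival b x (pi t) (X t) &
      forall k, only_jump N (Some k) t -> X t = remove_job x k]].

(* sigma t maps each server to the buffer it serves at time t; it may change
   only upon an arrival or an actual departure. *)
Definition decoupled_path (b : option nat) (N : option 'I_n -> R -> nat)
    (sigma : R -> {perm 'I_n}) (X : R -> queues n) : Prop :=
  [/\ step_path X, step_path sigma, (forall t, 0 <= t -> fits b (X t)) &
  forall t x p, 0 < t -> left_limit X t x -> left_limit sigma t p ->
  [/\ (forall c, ~ jumps (N c) t) -> X t = x,
      only_jump N None t -> exists k, arrival b x k (X t),
      forall k, only_jump N (Some k) t -> X t = remove_job x (p k) &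
      ~ jumps (N None) t -> X t = x -> sigma t = p]].

Definition fastest_serves_longest (mu : 'I_n -> R) (p : {perm 'I_n})
    (x : queues n) : Prop :=
  forall k k', mu k < mu k' -> (x (p k) <= x (p k'))%N.

Definition slowest_serves_longest (mu : 'I_n -> R) (p : {perm 'I_n})
    (x : queues n) : Prop :=
  forall k k', mu k < mu k' -> (x (p k') <= x (p k))%N.

End paths.

Section processes.
Context {R : realType} {d : measure_display} {Omega : measurableType d}.
Variable P : probability Omega R.

Definition filtration (F : R -> set (set Omega)) : Prop :=
  [/\ forall t, 0 <= t -> sigma_algebra setT (F t),
      forall t, 0 <= t -> F t `<=` measurable &
      forall s t, 0 <= s -> s <= t -> F s `<=` F t].

(* Only used for processes with values in a countable type. *)
Definition adapted {T : Type} (F : R -> set (set Omega)) (Y : R -> Omega -> T)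
    : Prop :=
  forall t y, 0 <= t -> F t [set w | Y t w = y].

Definition increment (N : R -> Omega -> nat) (s t : R) (m : nat) : set Omega :=
  [set w | N t w = (N s w + m)%N].

(* (N c)_c are mutually independent Poisson processes of rates r c relative to
   the filtration F: increments over ]s, t] are Poisson distributed, mutually
   independent, and independent of F s. *)
Definition poisson_processes {I : finType} (F : R -> set (set Omega))
    (r : I -> R) (N : I -> R -> Omega -> nat) : Prop :=
  [/\ forall c w, counting_path (fun t => N c t w),
      forall c, adapted F (N c),
      forall c s t m, 0 <= s -> s < t ->
        P (increment (N c) s t m) = (poisson_pmf (r c * (t - s)) m)%:E &
      forall s t (E : set Omega) (m : I -> nat), 0 <= s -> s < t -> F s E ->
        P (E `&` [set w | forall c, increment (N c) s t (m c) w]) =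
        (P E * \prod_(c : I) P (increment (N c) s t (m c)))%E].

Context {n : nat}.
Variables (b : option nat) (lam : R) (mu : 'I_n -> R).
Variable A : R -> Omega -> nat.

(* The filtration F carries everything known up to each time, possibly including
   external randomization. The tie-breaking rule is arbitrary but cannot see
   the future: X is adapted to F, whereas the future of the clocks is
   independent of the past of F. *)
Definition jsq_system (pi : R -> Omega -> 'I_n) (X : R -> Omega -> queues n)
    : Prop :=
  exists (F : R -> set (set Omega)) (S : 'I_n -> R -> Omega -> nat),
  [/\ filtration F,
      poisson_processes F (clocks (n%:R * lam) mu) (clocks A S),
      adapted F X &
      forall w, jsq_path b (fun c t => clocks A S c t w)
                  (fun t => pi t w) (fun t => X t w)].

Definition decoupled_system
    (rule : {perm 'I_n} -> queues n -> Prop) (X : R -> Omega -> queues n)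
    : Prop :=
  exists (F : R -> set (set Omega)) (S : 'I_n -> R -> Omega -> nat)
    (sigma : R -> Omega -> {perm 'I_n}),
  [/\ filtration F,
      poisson_processes F (clocks (n%:R * lam) mu) (clocks A S),
      adapted F X /\ adapted F sigma,
      forall w, decoupled_path b (fun c t => clocks A S c t w)
                  (fun t => sigma t w) (fun t => X t w) &
      forall t w, 0 <= t -> rule (sigma t w) (X t w)].

Definition jsq_fsl_system := decoupled_system (fastest_serves_longest mu).

Definition jsq_ssl_system := decoupled_system (slowest_serves_longest mu).

End processes.

(* The usual stochastic order. *)
Definition st_le {R : realType}
    {d : measure_display} {T : measurableType d} (P : probability T R)
    {d' : measure_display} {T' : measurableType d'} (P' : probability T' R)
    (U : T -> \bar R) (V : T' -> \bar R) : Prop :=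
  forall a : R, (P [set w | a%:E < U w] <= P' [set w | a%:E < V w])%E.

(* Main.v *)
Require Import Defs.
From HB Require Import structures.
From mathcomp Require Import all_boot all_order all_algebra all_fingroup.
From mathcomp Require Import all_classical all_reals all_analysis.
From mathcomp Require Import measurable_realfun.
From mathcomp Require Import zify ring lra.

Set Implicit Arguments.
Unset Strict Implicit.
Unset Printing Implicit Defensive.

Import Order.TTheory GRing.Theory Num.Theory.
Import numFieldNormedType.Exports.

Local Open Scope classical_set_scope.
Local Open Scope ring_scope.

(* Order states by all the tail sums Q_{+i} simultaneously. Arrivals to shortest
   buffers preserve this order, and so do departures from buffers of equal rank;
   moreover a departure from a longer buffer leaves a smaller state. Hence, by
   the rearrangement inequality, among all assignments of servers to buffers the
   FSL one minimizes, and the SSL one maximizes, the expected value of a monotone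
   function after the next departure.
   JSQ with an arbitrary adapted tie-breaking rule need not be Markov, and the
   systems need not be coupled, so time is discretized. Over a step of length h
   at most one clock rings, up to probability O(h^2), and the state then changes
   as prescribed by the current state and assignment. So E g(X (s + h)) is
   E (euler h sigma g)(X s) up to O(h^2), uniformly in g with values in [0, 1].
   Minimizing the Euler step over all assignments yields an operator that
   preserves monotonicity, is attained by FSL and is a lower bound for JSQ. With
   t / h steps the errors add up to O(h), and h -> 0 gives the first inequality;
   the second one is the same argument for the reversed order. *)

(** * The tail order on queue lengths *)

(** Induction on the number of points moved by [s]. Among them, [k] has the least [mu] and, among
    ties, the largest [a]; since [anti] is silent on equal [mu], this second choice is what makes
    [a k] maximal over all moved points. Composing with a transposition then fixes [k] without
    increasing the sum. *)
Lemma rearrangement (R : realDomainType) (I : finType) (mu a : I -> R)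
    (s : {perm I}) :
  (forall k l, mu k < mu l -> a l <= a k) ->
  \sum_k mu k * a k <= \sum_k mu k * a (s k).
Proof.
move=> anti; have [m] := ubnP #|[pred k | s k != k]|.
elim: m s => // m IH s; rewrite ltnS => sm.
have [k0 /= sk0|s1] := pickP [pred k | s k != k]; last first.
  rewrite le_eqVlt; apply/orP; left; apply/eqP; apply: eq_bigr => k _.
  by have /negbFE/eqP -> := s1 k.
have [k1 sk1 mu_min] := @arg_minP _ _ _ k0 (fun k => s k != k) mu sk0.
have [k /andP[sk /eqP muk] a_max] :=
  @arg_maxP _ _ _ k1
    (fun k => (s k != k) && (mu k == mu k1)) a (introT andP (conj sk1 (eqxx _))).
have mu_le l : s l != l -> mu k <= mu l by move=> sl; rewrite muk; exact: mu_min.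
have a_ge l : s l != l -> a l <= a k.
  move=> sl; have := mu_le _ sl; rewrite le_eqVlt => /orP[/eqP mukl|/anti//].
  by apply: a_max; rewrite sl -mukl muk eqxx.
pose j := (s^-1)%g k.
have sj : s j = k by rewrite /j permKV.
have jk : j != k by apply: contraNneq sk => jk; rewrite -{1}jk sj.
have ssk : s (s k) != s k by rewrite (inj_eq perm_inj).
pose s' := (tperm j k * s)%g.
have s'k : s' k = k by rewrite permM tpermR.
have s'j : s' j = s k by rewrite permM tpermL.
have s'E l : l != j -> l != k -> s' l = s l.
  by move=> lj lk; rewrite permM tpermD // eq_sym.
apply: le_trans (IH s' _) _.
  apply: leq_trans sm; apply: proper_card; apply/properP; split.
    apply/fintype.subsetP => l; rewrite !inE.
    have [->|lk] := eqVneq l k; first by rewrite s'k eqxx.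
    have [->|lj] := eqVneq l j; first by rewrite sj (eq_sym k) jk.
    by rewrite s'E.
  by exists k; rewrite !inE // s'k eqxx.
have split (f : I -> R) :
    \sum_l f l = f k + (f j + \sum_(l | (l != k) && (l != j)) f l).
  by rewrite (bigD1 k) //= (bigD1 j).
rewrite !split s'k s'j sj.
rewrite [X in _ + (_ + X) <= _](eq_bigr (fun l => mu l * a (s l))); last first.
  by move=> l /andP[lk lj]; rewrite s'E.
(* The sum drops by [(mu j - mu k) * (a k - a (s k))], a product of nonnegative factors. *)
have h1 : mu k <= mu j by apply: mu_le; rewrite sj eq_sym.
have h2 := a_ge _ ssk.
by nra.
Qed.

Section tail_order.
Context {n : nat}.
Implicit Types (x y : queues n) (k : 'I_n).

(* This is Q_{+i}: a buffer with x jobs is counted once for each level j in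
   [i, x], that is x + 1 - i times (truncated). *)
Definition tail_sum x (i : nat) : nat := (\sum_k ((x k).+1 - i))%N.

Definition tail_le x y : Prop := forall i, (tail_sum x i <= tail_sum y i)%N.

Definition tail_ge x y : Prop := tail_le y x.

Lemma tail_le_refl x : tail_le x x. Proof. by []. Qed.

Lemma occupancy_sum x i : occupancy x i = (\sum_k (i <= x k))%N.
Proof.
rewrite /occupancy -sum1_card big_mkcond /=.
by apply: eq_bigr => k _; rewrite inE; case: ifP.
Qed.

Lemma tail_sum_recl x i : tail_sum x i = (occupancy x i + tail_sum x i.+1)%N.
Proof.
rewrite /tail_sum occupancy_sum -big_split /=.
by apply: eq_bigr => k _; lia.
Qed.

Lemma tail_sum_eq0 x i : (forall k, x k < i)%N -> tail_sum x i = 0%N.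
Proof. by move=> xi; apply: big1 => k _; apply/eqP; rewrite subn_eq0. Qed.

Lemma tail_le_of_occupancy x y : occupancy x =1 occupancy y -> tail_le x y.
Proof.
(* Both tail sums vanish above level [m], which starts a downward induction on the level. *)
move=> xy i; pose m := (\max_k x k + \max_k y k)%N.
have xm : tail_sum x (i + m.+1) = 0%N.
  apply: tail_sum_eq0 => k; have := @leq_bigmax _ x k; rewrite /m; lia.
have ym : tail_sum y (i + m.+1) = 0%N.
  apply: tail_sum_eq0 => k; have := @leq_bigmax _ y k; rewrite /m; lia.
elim: m.+1 i xm ym => [|p IH] i; first by rewrite addn0 => -> ->.
move=> xm ym; rewrite tail_sum_recl [leqRHS]tail_sum_recl xy leq_add2l.
by apply: IH; rewrite addSnnS.
Qed.

Lemma tail_sum_add x k i :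
  tail_sum (add_job x k) i = (tail_sum x i + (i <= (x k).+1))%N.
Proof.
rewrite /tail_sum (bigD1 k) //= [in RHS](bigD1 k) //= ffunE eqxx.
rewrite (eq_bigr (fun l => ((x l).+1 - i)%N)); last first.
  by move=> l /negbTE lk; rewrite ffunE lk addn0.
by rewrite addnAC; congr addn; lia.
Qed.

(** The additive form avoids truncated subtraction. The condition [0 < x k] matters at [i = 0]: an
    empty buffer reaches level 0 but has no job to lose. *)
Lemma tail_sum_remove x k i :
  (tail_sum (remove_job x k) i + ((0 < x k) && (i <= x k)))%N = tail_sum x i.
Proof.
rewrite /tail_sum (bigD1 k) //= [in RHS](bigD1 k) //= ffunE eqxx.
rewrite (eq_bigr (fun l => ((x l).+1 - i)%N)); last first.
  by move=> l /negbTE lk; rewrite ffunE lk subn0.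
by rewrite addnAC; congr addn; lia.
Qed.

Lemma tail_le_remove x k k' :
  (x k <= x k')%N -> tail_le (remove_job x k') (remove_job x k).
Proof.
move=> kk' i; have := tail_sum_remove x k i; have := tail_sum_remove x k' i.
by lia.
Qed.

Lemma tail_le_leq x y : (forall k, x k <= y k)%N -> tail_le x y.
Proof. by move=> xy i; apply: leq_sum => k _; rewrite leq_sub2r // ltnS. Qed.

Lemma fits_add_job b x k :
  fits b x -> ~~ all_full b x -> shortest x k -> fits b (add_job x k).
Proof.
case: b => //= c /forallP xc /forallPn[k' xk'] /forallP xk.
apply/forallP => j; rewrite ffunE; have [->|_] := eqVneq j k.
  by have := xk k'; lia.
by rewrite addn0.
Qed.

Lemma fits_arrival b x k x' : fits b x -> arrival b x k x' -> fits b x'.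
Proof.
rewrite /arrival => xb; case: ifPn => [_ -> //|nf [xk ->]].
exact: fits_add_job.
Qed.

Lemma fits_remove b x k : fits b x -> fits b (remove_job x k).
Proof.
case: b => //= c /forallP xc; apply/forallP => j; rewrite ffunE.
exact: leq_trans (leq_subr _ _) (xc j).
Qed.

(** While [i] exceeds the least length by at most one, no term of [tail_sum] is truncated, so the
    sum is linear in [i]. *)
Lemma tail_sum_shortest x k i : (i <= (x k).+1)%N -> shortest x k ->
  (tail_sum x i + n * i)%N = tail_sum x 0.
Proof.
move=> ik /forallP xk; rewrite /tail_sum -[n in (n * i)%N]card_ord -sum_nat_const.
by rewrite -big_split /=; apply: eq_bigr => l _; have := xk l; lia.
Qed.

(** The term of buffer [k] is truncated here, whence the strict inequality. *)
Lemma tail_sum_truncated x k i : ((x k).+1 < i)%N ->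
  (tail_sum x 0 < tail_sum x i + n * i)%N.
Proof.
move=> ik; rewrite /tail_sum -[n in (n * i)%N]card_ord -sum_nat_const.
rewrite -big_split /= (bigD1 k) //= [ltnRHS](bigD1 k) //=.
rewrite -addSn; apply: leq_add; first by lia.
by apply: leq_sum => l _; lia.
Qed.

(** An accepted job can break the order only at a level [i] that counts it in [x] but not in [y].
    There [tail_sum_shortest] for [x] and [tail_sum_truncated] for [y], combined with the order at
    level 0, show that the two tail sums already differ. *)
Lemma arrival_tail_le b x y k k' x' y' : fits b x -> fits b y -> tail_le x y ->
  arrival b x k x' -> arrival b y k' y' -> tail_le x' y'.
Proof.
move=> xb yb xy ax ay; have := fits_arrival xb ax.
move: ax ay; rewrite /arrival; case: ifPn => [_|xf].
  move=> ->; case: ifPn => [_ -> //|_ [_ ->] _ i].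
  by rewrite tail_sum_add (leq_trans (xy i)) // leq_addr.
(* If only [y] is full, its buffers are all at capacity, so no state that fits can exceed it in any
   buffer. *)
move=> [xk ->]; case: ifPn => [yf -> xb'|yf [yk ->] _ i].
  apply: tail_le_leq => j; case: b yf xb' {xb yb xf} => //= c.
  by move=> /forallP/(_ j) yc /forallP/(_ j) xc; exact: leq_trans yc.
rewrite !tail_sum_add; have := xy i.
have [ik|] := leqP i (x k).+1; have [ik'|ik'] := leqP i (y k').+1; try lia.
have := tail_sum_shortest ik xk; have := tail_sum_truncated ik'.
by have := xy 0%N; lia.
Qed.

Lemma sorting_perm x : exists r : {perm 'I_n},
  forall i j : 'I_n, (i <= j)%N -> (x (r j) <= x (r i))%N.
Proof.
pose e := [rel i j : 'I_n | (x j <= x i)%N].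
have e_total : total e by move=> i j; exact: leq_total.
have e_trans : transitive e by move=> j i l /= ij jl; exact: leq_trans ij.
have st : size (sort e (enum 'I_n)) == n.
  by rewrite size_sort size_enum_ord.
have : perm_eq (Tuple st) (ord_tuple n).
  by rewrite /= perm_sort.
case/tuple_permP => r /= re.
exists r => i j ij.
have k0 := i.
have nthE (l : 'I_n) : nth k0 (sort e (enum 'I_n)) l = r l.
  by rewrite re (nth_map l) ?size_enum_ord // tnth_ord_tuple nth_ord_enum.
rewrite -!nthE.
apply: (sorted_leq_nth e_trans (fun i => leqnn _) k0
  (sort_sorted e_total (enum 'I_n))) => //; rewrite inE (eqP st); exact: ltn_ord.
Qed.

(** Sorting makes the ranks that reach level [i] an initial segment, so membership reduces to
    comparing the rank with its cardinality. *)
Lemma occupancy_sorted x (r : {perm 'I_n}) (j : 'I_n) i :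
  (forall k l : 'I_n, (k <= l)%N -> (x (r l) <= x (r k))%N) ->
  (i <= x (r j))%N = (j < occupancy x i)%N.
Proof.
move=> xr.
have -> : occupancy x i = #|[set k : 'I_n | (i <= x (r k))%N]%SET|.
  rewrite occupancy_sum (reindex_inj (@perm_inj _ r)) /= -sum1_card big_mkcond.
  by rewrite [in RHS]big_mkcond /=; apply: eq_bigr => k _; rewrite inE; case: leqP.
have cardlt m : (m <= n)%N -> #|[set k : 'I_n | (k < m)%N]%SET| = m.
  move=> mn; rewrite -sum1_card.
  rewrite (eq_bigl (fun k : 'I_n => (k < m)%N)); last by move=> k; rewrite inE.
  by rewrite (big_ord_narrow mn) sum1_card card_ord.
apply/idP/idP => [ij|].
  rewrite -(cardlt j.+1 (ltn_ord j)); apply: subset_leq_card.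
  by apply/fintype.subsetP => k; rewrite !inE ltnS => /xr; exact: leq_trans.
apply: contraTT; rewrite -ltnNge -leqNgt => ij.
rewrite -[X in (_ <= X)%N](cardlt j (ltnW (ltn_ord j))).
apply/subset_leq_card/fintype.subsetP => k; rewrite !inE; apply: contraTT.
by rewrite -leqNgt -ltnNge => /xr/leq_ltn_trans; apply.
Qed.

(* The buffers of the two systems are paired by rank. If the rank-j buffer of y
   reaches level i but that of x does not, then fewer buffers of x reach level
   i, so that the tail sums at level i differ and can absorb the departure. *)
Lemma removal_coupling x y : tail_le x y -> exists s : {perm 'I_n},
  forall k, tail_le (remove_job x (s k)) (remove_job y k).
Proof.
move=> xy; have [rx rxP] := sorting_perm x; have [ry ryP] := sorting_perm y.
exists (ry^-1 * rx)%g => k; rewrite permM; set j := (ry^-1)%g k.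
have -> : k = ry j by rewrite permKV.
move=> i; have := xy i.
have strict m : (x (rx j) < m)%N -> (m <= y (ry j))%N ->
    (tail_sum x m < tail_sum y m)%N.
  rewrite ltnNge (occupancy_sorted _ _ rxP) (occupancy_sorted _ _ ryP) -leqNgt.
  by rewrite !(tail_sum_recl _ m); have := xy m.+1; lia.
have := strict i; have := strict 1%N.
have := tail_sum_remove x (rx j) i; have := tail_sum_remove y (ry j) i.
have occ0 (z : queues n) : occupancy z 0 = n.
  by rewrite occupancy_sum sum_nat_const muln1 card_ord.
(* At level 0 every buffer counts, even an empty one, so this level is level 1 shifted by [n] in
   both systems. *)
have [->|i0] := posnP i; last by lia.
by rewrite !(tail_sum_recl x 0) !(tail_sum_recl y 0) !occ0; lia.
Qed.

End tail_order.

(** * Paths between two times with at most one ring *)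

Section step_paths.
Context {R : realType}.
Implicit Types (s t u v : R).

(** Let [E] be the set of times up to which [Q] holds throughout. The left-closure hypothesis gives
    [Q] at [sup E], and the right-extension hypothesis would push beyond [sup E] if it were less
    than [t]. *)
Lemma real_induction s t (Q : R -> Prop) : s <= t -> Q s ->
  (forall u, s <= u < t -> (forall v, s <= v <= u -> Q v) ->
    \forall v \near u^'+, Q v) ->
  (forall u, s < u <= t -> (forall v, s <= v < u -> Q v) -> Q u) ->
  forall u, s <= u <= t -> Q u.
Proof.
move=> st Qs Qr Ql.
pose E := [set u | s <= u <= t /\ forall v, s <= v <= u -> Q v].
have Es : E s.
  split; first by rewrite lexx.
  by move=> v /le_anti <-.
have Eub : ubound E t by move=> u [/andP[]].
have Esup : has_sup E by split; [exists s | exists t].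
have sm : s <= sup E by apply: ub_le_sup => //; exact: (proj2 Esup).
have mt : sup E <= t by apply: ge_sup => //; exact: (proj1 Esup).
have Qlt v : s <= v < sup E -> Q v.
  move=> /andP[sv vm]; have [e [_ Ee] ve] := sup_gt (proj1 Esup) vm.
  by apply: Ee; rewrite sv ltW.
have Qm : Q (sup E).
  move: sm; rewrite le_eqVlt => /predU1P[<- //|sm].
  by apply: Ql => //; rewrite sm.
have Qle v : s <= v <= sup E -> Q v.
  move=> /andP[sv]; rewrite le_eqVlt => /predU1P[-> //|vm].
  by apply: Qlt; rewrite sv.
suff mE : sup E = t by move=> u ?; apply: Qle; rewrite mE.
apply/eqP; rewrite eq_le mt /= leNgt; apply/negP => mlt.
have /nbhs_ballP[e /= e0 He] := Qr _ (introT andP (conj sm mlt)) Qle.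
(* A point of the right neighborhood on which [Q] is known, capped at [t]. *)
pose w := Num.min t (sup E + e / 2).
have mw : sup E < w by rewrite lt_min mlt ltrDl divr_gt0.
suff : E w by move=> /(ub_le_sup (proj2 Esup)); rewrite leNgt mw.
split; first by rewrite (le_trans sm (ltW mw)) ge_min lexx.
move=> v /andP[sv vw]; have [vm|mv] := leP v (sup E).
  by apply: Qle; rewrite sv.
apply: He => //=; rewrite /ball /= distrC ger0_norm ?subr_ge0 1?ltW //.
move: vw; rewrite le_min => /andP[_]; lra.
Qed.

Lemma left_limit_point (T : Type) (f : R -> T) s u l : s < u ->
  left_limit f u l -> exists2 v, s < v < u & f v = l.
Proof.
move=> su fl.
have : \forall v \near u^'-, [/\ f v = l, s < v & v < u].
  near=> v; split; near: v;
    [exact: fl | exact: nbhs_left_gt | exact: nbhs_left_lt].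
move=> /(@filter_ex _ _ (at_left_proper_filter u))[v [fv sv vu]]; exists v => //; exact/andP.
Unshelve. all: by end_near.
Qed.

Lemma left_limit_cst (T : Type) (f : R -> T) s u l : s < u ->
  (forall v, s <= v < u -> f v = l) -> left_limit f u l.
Proof.
move=> su fl; near=> v; apply: fl; apply/andP; split; first near: v.
- by apply: filterS (nbhs_left_gt su) => v /ltW.
- by near: v; exact: nbhs_left_lt.
Unshelve. all: by end_near. Qed.

Lemma step_path_cst (T : Type) (f : R -> T) s t : step_path f -> 0 <= s ->
  (forall u l, s < u <= t -> left_limit f u l -> f u = l) ->
  forall u, s <= u <= t -> f u = f s.
Proof.
move=> [fr fl] s0 fE u0 /andP[su0 u0t]; have st := le_trans su0 u0t.
suff fcst : forall u, s <= u <= t -> f u = f s by apply: fcst; rewrite su0.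
apply: (real_induction st) => // u.
- move=> /andP[su _] fs; have := fr u (le_trans s0 su).
  by apply: filterS => v ->; apply: fs; rewrite su lexx.
- move=> /andP[su ut] fs; have [l lu] := fl u (le_lt_trans s0 su).
  have [v /andP[sv vu] fv] := left_limit_point su lu.
  by rewrite (fE u l) ?su // -fv fs // vu ltW.
Qed.

(** State and assignment are followed jointly, because the assignment is known to stay put only
    while the state does. *)
Lemma step_path_pair (T U : Type) (f : R -> T) (g : R -> U) :
  step_path f -> step_path g -> step_path (fun t => (f t, g t)).
Proof.
move=> [fr fl] [gr gl]; split => t t0.
  by apply: filterS2 (fr t t0) (gr t t0) => s -> ->.
have [[l lP] [m mP]] := (fl t t0, gl t t0).
by exists (l, m); apply: filterS2 lP mP => s -> ->.
Qed.

Lemma counting_path_nondecreasing (N : R -> nat) s t : counting_path N ->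
  0 <= s -> s <= t -> (N s <= N t)%N.
Proof.
move=> [_ [Nr _] NE] s0 st.
suff /(_ t) : forall u, s <= u <= t -> (N s <= N u)%N by apply; rewrite st lexx.
apply: (real_induction st) => // u.
- move=> /andP[su _] Ns; have := Nr u (le_trans s0 su).
  by apply: filterS => v ->; apply: Ns; rewrite su lexx.
- move=> /andP[su ut] Ns; have [[m [mu ->]]|mu] := NE u (le_lt_trans s0 su).
    have [v /andP[sv vu] <-] := left_limit_point su mu.
    by rewrite leqW // Ns // vu ltW.
  have [v /andP[sv vu] <-] := left_limit_point su mu.
  by rewrite Ns // vu ltW.
Qed.

Lemma counting_path_no_jump (N : R -> nat) s t : counting_path N ->
  0 <= s -> N t = N s -> forall u, s < u <= t -> ~ jumps N u.
Proof.
move=> NP s0 Nts u /andP[su ut] [m [mu Nu]].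
have [v /andP[sv vu] Nv] := left_limit_point su mu.
have := counting_path_nondecreasing NP s0 (ltW sv).
have := counting_path_nondecreasing NP (le_trans s0 (ltW su)) ut.
by rewrite Nv Nu Nts; lia.
Qed.

(** Otherwise real induction would keep [N] constant: the first time at which it leaves [N s] is a
    jump, and monotonicity forces the value there to be [N t] already. *)
Lemma counting_path_one_jump (N : R -> nat) s t : counting_path N ->
  0 <= s -> s <= t -> N t = (N s).+1 ->
  exists2 u, s < u <= t & [/\ jumps N u, forall v, s <= v < u -> N v = N s &
                             N t = N u].
Proof.
move=> NP s0 st Nt; have ndN := counting_path_nondecreasing NP.
have [_ [Nr _] NE] := NP.
apply: contrapT => nex.
suff /(_ t) : forall u, s <= u <= t -> N u = N s.
  by rewrite st lexx Nt => /(_ isT); lia.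
apply: (real_induction st) => // u.
- move=> /andP[su _] Ns; have := Nr u (le_trans s0 su).
  by apply: filterS => v ->; apply: Ns; rewrite su lexx.
- move=> /andP[su ut] Ns; apply: contrapT => Nu; apply: nex; exists u.
    by rewrite su.
  have u0 := le_trans s0 (ltW su).
  have Ntu : N t = N u.
    by have := ndN _ _ s0 (ltW su); have := ndN _ _ u0 ut; rewrite Nt; lia.
  split => //; exists (N s); split; last by rewrite -Ntu.
  exact: left_limit_cst su Ns.
Qed.

End step_paths.

(** * State changes of decoupled paths between rings and at a single ring *)

Section decoupled_paths.
Context {R : realType} {n : nat}.
Variables (b : option nat) (N : option 'I_n -> R -> nat).
Variables (sigma : R -> {perm 'I_n}) (X : R -> queues n).
Hypothesis N_counting : forall c, counting_path (N c).
Hypothesis X_path : decoupled_path b N sigma X.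
Implicit Types (s t u v : R).

Lemma decoupled_path_quiet s t : 0 <= s ->
  (forall u c, s < u <= t -> ~ jumps (N c) u) ->
  forall u, s <= u <= t -> X u = X s /\ sigma u = sigma s.
Proof.
move=> s0 Nst u ust; have [Xs sigmas _ XE] := X_path.
suff : (X u, sigma u) = (X s, sigma s) by move=> [-> ->].
move: u ust.
apply: (step_path_cst (step_path_pair Xs sigmas) s0) => u [x p] sut up.
have ux : left_limit X u x by apply: filterS up => v [].
have {}up : left_limit sigma u p by apply: filterS up => v [].
have u0 : 0 < u by case/andP: sut => /(le_lt_trans s0).
have [Xq _ _ sq] := XE u x p u0 ux up.
have Xu : X u = x by apply: Xq => c; exact: Nst.
by rewrite Xu sq //; exact: Nst.
Qed.

Lemma decoupled_path_no_ring s t : 0 <= s -> s <= t ->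
  (forall c, N c t = N c s) -> X t = X s.
Proof.
move=> s0 st Nst.
suff /(_ t) : forall u, s <= u <= t -> X u = X s /\ sigma u = sigma s.
  by rewrite st lexx => /(_ isT)[].
apply: decoupled_path_quiet => // u c; exact: counting_path_no_jump.
Qed.

(** Nothing moves before the ring time [u], so the left limits there are the state and assignment at
    [s]; the state does not move after [u] either. *)
Lemma decoupled_path_one_ring s t c : 0 <= s -> s <= t ->
  (forall c', N c' t = (N c' s + (c' == c))%N) ->
  if c is Some k then X t = remove_job (X s) (sigma s k)
  else exists k, arrival b (X s) k (X t).
Proof.
move=> s0 st Nst.
have Nc : N c t = (N c s).+1 by rewrite Nst eqxx addn1.
have No c' : c' != c -> N c' t = N c' s by rewrite Nst => /negbTE ->; rewrite addn0.
have [u /andP[su ut] [Ju Nv Ntu]] := counting_path_one_jump (N_counting c) s0 st Nc.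
have u0 := le_lt_trans s0 su.
have before v : s <= v < u -> X v = X s /\ sigma v = sigma s.
  move=> /andP[sv vu]; apply: (@decoupled_path_quiet s v); rewrite ?sv //=.
  move=> w c' /andP[sw wv].
  have [->|cc'] := eqVneq c' c.
    apply: (counting_path_no_jump (N_counting c) s0) (introT andP (conj sw wv)).
    by apply: Nv; rewrite sv.
  apply: (counting_path_no_jump (N_counting c') s0 (No _ cc')).
  by rewrite sw (le_trans wv) // (le_trans (ltW vu)).
have Xu : left_limit X u (X s) by apply: left_limit_cst su _ => v /before[].
have su' : left_limit sigma u (sigma s).
  by apply: left_limit_cst su _ => v /before[].
have only : only_jump N c u.
  split => // c' Jc'; apply: contrapT => /eqP cc'.
  by apply: (counting_path_no_jump (N_counting c') s0 (No _ cc') _ Jc'); rewrite su.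
have Xtu : X t = X u.
  suff /(_ t) : forall v, u <= v <= t -> X v = X u /\ sigma v = sigma u.
    by rewrite ut lexx => /(_ isT)[].
  apply: decoupled_path_quiet; first exact: ltW.
  move=> v c' /andP[uv vt]; have [->|cc'] := eqVneq c' c.
    apply: (counting_path_no_jump (N_counting c) (ltW u0) Ntu).
    by rewrite uv.
  apply: (counting_path_no_jump (N_counting c') s0 (No _ cc')).
  by rewrite (lt_trans su uv).
have [_ _ _ /(_ u _ _ u0 Xu su')[_ Xa Xd _]] := X_path.
by rewrite Xtu; case: c only {Nst Nc No Nv Ntu Ju before} => [k|] only;
  [exact: Xd|exact: Xa].
Qed.

End decoupled_paths.

(** In JSQ each server keeps its own buffer, which is the identity assignment; this lets one
    analysis cover all three systems. *)
Lemma jsq_path_decoupled (R : realType) (n : nat) (b : option nat)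
    (N : option 'I_n -> R -> nat) (pi : R -> 'I_n) (X : R -> queues n) :
  jsq_path b N pi X -> decoupled_path b N (fun=> 1%g) X.
Proof.
move=> [Xs Xb XE]; split => //.
  split => [t _|t _]; first by near=> s.
  by exists 1%g; near=> s.
move=> t x p t0 tx tp; have [X1 X2 X3] := XE t x t0 tx; split => //.
- by move=> /X2; exists (pi t).
- move=> k /X3 ->; congr (remove_job x _).
  by have [v _ <-] := left_limit_point t0 tp; rewrite perm1.
- by move=> _ _; have [v _ <-] := left_limit_point t0 tp.
Unshelve. all: by end_near. Qed.

(** * Discrete random variables and Poisson clocks *)

Lemma big_option (V : nmodType) (I : finType) (F : option I -> V) :
  \sum_c F c = F None + \sum_i F (Some i).
Proof.
rewrite (bigD1 None) //=; congr (_ + _).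
rewrite (reindex_omap Some id) /=; last by case.
by apply: eq_bigl => i; rewrite eqxx.
Qed.

Lemma sigma_algebraI (T : Type) (G : set (set T)) (A B : set T) :
  sigma_algebra setT G -> G A -> G B -> G (A `&` B).
Proof. by move=> /(sigma_algebraP (fun _ _ => @subsetT _ _))[_ _ _]; apply. Qed.

(** The preimage is a union over the codes [pickle], each piece being empty or a fiber. A general
    [G] allows both the measurable sets and the past [F s]. *)
Lemma sigma_algebra_countable_preimage (T : Type) (U : countType) (G : set (set T))
    (Z : T -> U) (B : set U) : sigma_algebra setT G ->
  (forall y, G [set w | Z w = y]) -> G (Z @^-1` B).
Proof.
move=> [G0 _ GU] GZ.
have -> : Z @^-1` B = \bigcup_k [set w | pickle (Z w) = k /\ B (Z w)].
  apply/seteqP; split => [w Bw|w [k _ []]//].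
  by exists (pickle (Z w)).
apply: GU => k.
have [[y [ky By]]|nk] := pselect (exists y, pickle y = k /\ B y).
  suff -> : [set w | pickle (Z w) = k /\ B (Z w)] = [set w | Z w = y] by [].
  apply/seteqP; split => w /=; last by move=> ->.
  by rewrite -ky => -[/(pcan_inj pickleK)].
suff -> : [set w | pickle (Z w) = k /\ B (Z w)] = set0 by [].
by apply/seteqP; split => w //= wk; apply: nk; exists (Z w).
Qed.

Section discrete_random_variables.
Context {R : realType} {d : measure_display} {Omega : measurableType d}.
Variable P : probability Omega R.

Lemma integrable_discrete (U : countType) (Z : Omega -> U) (g : U -> R) (M : R) :
  (forall y, measurable [set w | Z w = y]) -> (forall y, `|g y| <= M) ->
  P.-integrable setT (EFin \o (fun w => g (Z w))).
Proof.
move=> mZ gM; apply: measurable_bounded_integrable => //.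
- by rewrite (le_lt_trans (probability_le1 P measurableT)) // ltry.
- move=> _ B mB; rewrite setTI.
  exact: (@sigma_algebra_countable_preimage _ _ _ Z (g @^-1` B)
            (sigma_algebra_measurable Omega)).
- exists M; split; first exact: num_real.
  by move=> x Mx w _ /=; exact: le_trans (gM _) (ltW Mx).
Qed.

(** [D] is cut along the code of [Z], and the integrand is constant on each piece. The default 0 is
    harmless: a code of no value has an empty piece. *)
Lemma integral_discrete (m : {measure set Omega -> \bar R}) (U : countType)
    (Z : Omega -> U) (g : U -> R) (D : set Omega) :
  (forall y, measurable [set w | Z w = y]) -> measurable D ->
  (forall y, 0 <= g y) ->
  (\int[m]_(w in D) (g (Z w))%:E =
   \sum_(0 <= k <oo) (oapp g 0 (unpickle k))%:E *
                     m ([set w | pickle (Z w) = k] `&` D))%E.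
Proof.
move=> mZ mD g0.
have mpre (B : set U) : measurable (Z @^-1` B).
  exact: sigma_algebra_countable_preimage (sigma_algebra_measurable Omega) mZ.
pose F k := [set w | pickle (Z w) = k] `&` D.
have mF k : measurable (F k).
  by apply: measurableI => //; exact: (mpre [set y | pickle y = k]).
have DF : D = \bigcup_k F k.
  apply/seteqP; split => [w Dw|w [k _ []]//].
  by exists (pickle (Z w)).
have mg : measurable_fun (\bigcup_k F k) (EFin \o (fun w => g (Z w))).
  rewrite -DF => _ B mB.
  by apply: measurableI => //; exact: (mpre [set y | B (g y)%:E]).
have tF : trivIset setT F by move=> i j _ _ [w [[/= <- _] [/= <- _]]].
rewrite {1}DF (ge0_integral_bigcup _ mF mg) //; last first.
  by move=> w _; rewrite lee_fin.
apply: eq_eseriesr => k _; rewrite -integral_cst; last exact: mF.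
apply: eq_integral => w; rewrite inE => -[/= <- _].
by rewrite /cst pickleK.
Qed.

(** Independence factors each term of the series of [integral_discrete], and [P D] then comes out of
    the sum. *)
Lemma Rintegral_mul_indic (U : countType) (Z : Omega -> U) (g : U -> R)
    (D : set Omega) :
  (forall y, measurable [set w | Z w = y]) -> measurable D ->
  (forall y, 0 <= g y <= 1) ->
  (forall B, P (Z @^-1` B `&` D) = (P (Z @^-1` B) * P D)%E) ->
  \int[P]_w (g (Z w) * \1_D w) = fine (P D) * \int[P]_w g (Z w).
Proof.
move=> mZ mD g01 indep.
have g0 y : 0 <= g y by have /andP[] := g01 y.
have PD : P D = (fine (P D))%:E by rewrite fineK // fin_num_measure.
have -> : \int[P]_w (g (Z w) * \1_D w) = \int[P]_(w in D) g (Z w).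
  rewrite [RHS]Rintegral_mkcond; congr Rintegral; apply/funext => w.
  rewrite /= patchE indicE; case: (w \in D); rewrite ?mulr1 ?mulr0 //.
rewrite /Rintegral (integral_discrete P mZ mD g0).
rewrite [X in fine X](_ : _ = (fine (P D))%:E * \sum_(0 <= k <oo)
    (oapp g 0 (unpickle k))%:E * P ([set w | pickle (Z w) = k] `&` setT))%E.
  rewrite -(integral_discrete P mZ measurableT g0) fineM //.
  apply: integrable_fin_num => //; apply: integrable_discrete mZ _ => y.
  by rewrite ger0_norm //; have /andP[_] := g01 y; exact.
rewrite -nneseriesZl; last first.
  move=> k _; rewrite mule_ge0 // lee_fin; case: (unpickle k) => //=.
apply: eq_eseriesr => k _; rewrite setIT muleCA -PD; congr (_ * _)%E.
by rewrite muleC; exact: (indep [set y | pickle y = k]).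
Qed.

(** The pair formed by [Z] and membership in [D] is again a discrete variable. *)
Lemma integrable_discrete_indic (U : countType) (Z : Omega -> U) (g : U -> R)
    (D : set Omega) (M : R) :
  (forall y, measurable [set w | Z w = y]) -> measurable D ->
  (forall y, `|g y| <= M) ->
  P.-integrable setT (EFin \o (fun w => g (Z w) * \1_D w)).
Proof.
move=> mZ mD gM.
pose Z' w := (Z w, w \in D).
have mZ' y : measurable [set w | Z' w = y].
  have -> : [set w | Z' w = y] = [set w | Z w = y.1] `&` (if y.2 then D else ~` D).
    apply/seteqP; split => w /=; rewrite /Z'; case: y => y [] /=.
    - by move=> [-> /set_mem].
    - by move=> [-> /negbT/negP wD]; split=> // /mem_set.
    - by move=> [-> /mem_set ->].
    - by move=> [-> wD]; congr pair; apply/negbTE/negP => /set_mem.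
  by apply: measurableI => //; case: y.2 => //; exact: measurableC.
have := @integrable_discrete _ Z' (fun y => g y.1 * y.2%:R) M mZ'.
apply => -[y c]; rewrite normrM /=; apply: le_trans (gM y).
by rewrite ler_piMr // normr_nat; case: c.
Qed.

Lemma Rintegral_sum (I : finType) (f : I -> Omega -> R) :
  (forall i, P.-integrable setT (EFin \o f i)) ->
  \int[P]_w (\sum_i f i w) = \sum_i \int[P]_w f i w.
Proof.
move=> intf; rewrite /Rintegral.
under eq_integral do rewrite -sumEFin.
rewrite integral_sum // -sum_fine // => i _.
by apply: integrable_fin_num => //; exact: intf.
Qed.

Lemma Rintegrable_sum (I : finType) (f : I -> Omega -> R) :
  (forall i, P.-integrable setT (EFin \o f i)) ->
  P.-integrable setT (EFin \o (fun w => \sum_i f i w)).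
Proof.
move=> intf; have -> : EFin \o (fun w => \sum_i f i w) =
    (fun w => \sum_i (f i w)%:E)%E by apply/funext => w /=; rewrite sumEFin.
by apply: (@integrable_sum _ _ _ _ _ measurableT _ _ xpredT
  (fun i => EFin \o f i)) => i _; exact: intf.
Qed.

Lemma Rintegral_cst_prob (c : R) : \int[P]_w c = c.
Proof.
rewrite Rintegral_cst // -[RHS]mulr1; congr (_ * _).
exact: (congr1 fine (probability_setT P)).
Qed.

Lemma Rintegral_bounds (f : Omega -> R) :
  P.-integrable setT (EFin \o f) -> (forall w, 0 <= f w <= 1) ->
  0 <= \int[P]_w f w <= 1.
Proof.
move=> intf f01; apply/andP; split.
  by apply: Rintegral_ge0 => w _; have /andP[] := f01 w.
rewrite -[leRHS](Rintegral_cst_prob 1); apply: le_Rintegral => // [|w _]; last by have /andP[] := f01 w.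
exact: finite_measure_integrable_cst.
Qed.

(* The events E need not cover Omega: what they miss only contributes the error
   term 1 - \sum_a P (E a). *)
Lemma Rintegral_partition_bounds (I : finType) (U : countType) (Z : Omega -> U)
    (V : Omega -> R) (E : I -> set Omega) (phi : I -> U -> R) :
  (forall y, measurable [set w | Z w = y]) -> (forall a, measurable (E a)) ->
  (forall a a' w, E a w -> E a' w -> a = a') ->
  (forall a y, 0 <= phi a y <= 1) ->
  (forall a B, P (Z @^-1` B `&` E a) = (P (Z @^-1` B) * P (E a))%E) ->
  P.-integrable setT (EFin \o V) -> (forall w, 0 <= V w <= 1) ->
  (forall a w, E a w -> V w = phi a (Z w)) ->
  \sum_a fine (P (E a)) * \int[P]_w phi a (Z w) <= \int[P]_w V w <=
  \sum_a fine (P (E a)) * \int[P]_w phi a (Z w) + (1 - \sum_a fine (P (E a))).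
Proof.
move=> mZ mE disE phi01 indep intV V01 VE.
have phiM a y : `|phi a y| <= 1.
  by have /andP[p0 p1] := phi01 a y; rewrite ger0_norm.
pose J a w : R := phi a (Z w) * \1_(E a) w.
have intJ a : P.-integrable setT (EFin \o J a).
  exact: integrable_discrete_indic mZ (mE a) (phiM a).
have SE : \sum_a fine (P (E a)) * \int[P]_w phi a (Z w) =
    \int[P]_w (\sum_a J a w).
  rewrite Rintegral_sum //; apply: eq_bigr => a _.
  by rewrite -(Rintegral_mul_indic mZ (mE a) (phi01 a) (indep a)).
have intJs := Rintegrable_sum intJ.
pose K a w : R := \1_(E a) w.
have intK a : P.-integrable setT (EFin \o K a).
  exact: integrable_indic.
have intKs := Rintegrable_sum intK.
have KE : \sum_a fine (P (E a)) = \int[P]_w (\sum_a K a w).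
  rewrite Rintegral_sum //; apply: eq_bigr => a _.
  by rewrite /Rintegral integral_indic // setIT.
have int1 : P.-integrable setT (EFin \o (fun=> 1 : R)).
  exact: finite_measure_integrable_cst.
have int1K : P.-integrable setT (EFin \o (fun w => 1 - \sum_a K a w)).
  exact: (integrableB measurableT int1 intKs).
(* On an event [E a] the sum of the [J] is [V w] and that of the [K] is 1, so both bounds are
   equalities; off all events both sums vanish and the bounds read [0 <= V w <= 1]. *)
have pointwise w : (\sum_a J a w <= V w <= \sum_a J a w + (1 - \sum_a K a w)).
  have /andP[V0 V1] := V01 w.
  have [[a Ea]|nE] := pselect (exists a, E a w); last first.
    have ni a : w \in E a = false by apply/negbTE/negP => /set_mem ?; apply: nE; exists a.
    rewrite !big1; first by rewrite subr0 add0r V0.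
      by move=> a _; rewrite /K indicE ni.
    by move=> a _; rewrite /J indicE ni mulr0.
  have wa a' : w \in E a' = (a' == a).
    by apply/idP/eqP => [/set_mem Ea'|->]; [exact: disE Ea' Ea|exact: mem_set].
  have -> : \sum_a J a w = V w.
    rewrite (bigD1 a) //= big1 ?addr0 => [|a' /negbTE aa'].
      by rewrite /J indicE wa eqxx mulr1 -VE.
    by rewrite /J indicE wa aa' mulr0.
  have -> : \sum_a K a w = 1.
    rewrite (bigD1 a) //= big1 ?addr0 => [|a' /negbTE aa'].
      by rewrite /K indicE wa eqxx.
    by rewrite /K indicE wa aa'.
  by rewrite subrr addr0 lexx.
rewrite SE KE; apply/andP; split.
  by apply: le_Rintegral => // w _; have /andP[] := pointwise w.
rewrite -[X in _ + (X - _)](Rintegral_cst_prob 1) -RintegralB // -RintegralD //.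
apply: le_Rintegral => // [|w _]; last by have /andP[] := pointwise w.
exact: (integrableD measurableT intJs int1K).
Qed.

End discrete_random_variables.

(** * Ring patterns of the Poisson clocks over a time step *)

Section poisson_rings.
Context {R : realType} {d : measure_display} {Omega : measurableType d}.
Variable P : probability Omega R.
Context {I : finType}.
Variables (F : R -> set (set Omega)) (r : I -> R) (N : I -> R -> Omega -> nat).
Hypothesis F_filtration : filtration F.
Hypothesis N_poisson : poisson_processes P F r N.
Hypothesis r_gt0 : forall c, 0 < r c.

(* No clock rings in ]s, t] if a = None, and only the clock c does, exactly
   once, if a = Some c. *)
Definition ring_event (s t : R) (a : option I) : set Omega :=
  [set w | forall c, N c t w = (N c s w + (Some c == a))%N].

Lemma ring_event_inj s t a a' w :
  ring_event s t a w -> ring_event s t a' w -> a = a'.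
Proof.
move=> Ea Ea'.
have h c : (Some c == a) = (Some c == a').
  by have := Ea c; rewrite (Ea' c) => /addnI; do 2 case: eqP.
case: a a' h {Ea Ea'} => [c|] [c'|] h //.
- by have := h c; rewrite eqxx => /esym/eqP.
- by have := h c; rewrite eqxx.
- by have := h c'; rewrite eqxx.
Qed.

Lemma measurable_ring_event s t a : 0 <= s -> 0 <= t ->
  measurable (ring_event s t a).
Proof.
move=> s0 t0; have [_ Fm _] := F_filtration; have [_ adN _ _] := N_poisson.
have mN c u k : 0 <= u -> measurable [set w | N c u w = k].
  by move=> u0; apply: (Fm u u0); exact: adN.
have -> : ring_event s t a =
    \bigcap_(c in [set: I]) \bigcup_k ([set w | N c s w = k] `&`
                           [set w | N c t w = k + (Some c == a)]%N).
  apply/seteqP; split => [w wa c _|w wa c].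
    by exists (N c s w) => //; split => //; exact: wa.
  by have [k _ [/= -> ->]] := wa c Logic.I.
apply: fin_bigcap_measurable => // c _; apply: bigcupT_measurable => k.
by apply: measurableI; exact: mN.
Qed.

(** The independence clause is used twice, with [E] and with the whole space; the second use
    identifies the product of increment probabilities as that of the ring event. *)
Lemma ring_event_indep s t a E : 0 <= s -> s < t -> F s E ->
  P (E `&` ring_event s t a) = (P E * P (ring_event s t a))%E.
Proof.
move=> s0 st FE; have [_ _ _ indep] := N_poisson.
have [Fs _ _] := F_filtration.
have FT : F s setT by have [F0 /(_ _ F0)] := Fs s s0; rewrite setD0.
have := indep s t _ (fun c => Some c == a : nat) s0 st FT.
rewrite setTI probability_setT mul1e => ringE.
by have := indep s t E (fun c => Some c == a : nat) s0 st FE; rewrite -ringE.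
Qed.

Lemma ring_event_prob s t a : 0 <= s -> s < t ->
  P (ring_event s t a) =
  ((if a is Some c then r c * (t - s) else 1) *
   expR (- ((t - s) * \sum_c r c)))%:E.
Proof.
move=> s0 st; have [_ _ pmf indep] := N_poisson.
have [Fs _ _] := F_filtration.
have FT : F s setT by have [F0 /(_ _ F0)] := Fs s s0; rewrite setD0.
have := indep s t _ (fun c => Some c == a : nat) s0 st FT.
rewrite setTI probability_setT mul1e => ->.
under eq_bigr do rewrite pmf //.
rewrite prodEFin; congr EFin.
rewrite (eq_bigr (fun c => (if Some c == a then r c * (t - s) else 1) *
    expR (- (r c * (t - s))))); last first.
  (* The Poisson parameter is positive and each increment is 0 or 1, so the factorial is 1. *)
  move=> c _; rewrite /poisson_pmf mulr_gt0 ?subr_gt0 //.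
  have -> : (Some c == a : nat)`! = 1%N by case: (Some c == a).
  by rewrite invr1 mulr1; case: (Some c == a); rewrite ?expr1 ?expr0.
rewrite big_split /= -expR_sum; congr (_ * expR _); last first.
  by rewrite sumrN mulr_sumr; congr (- _); apply: eq_bigr => c _; rewrite mulrC.
rewrite -big_mkcond /=; case: a => [c|]; last by rewrite big_pred0.
by rewrite (big_pred1 c).
Qed.

End poisson_rings.

(** * Euler steps and comparison *)

Section euler_operator.
Context {R : realType} {n : nat}.
Variables (b : option nat) (k0 : 'I_n) (r : option 'I_n -> R).
Implicit Types (x y : queues n) (p : {perm 'I_n}) (g : queues n -> R).

(** One fixed shortest buffer stands for every tie-breaking choice; [arrival_route] shows that
    monotone functions cannot tell the difference. [k0] merely seeds the minimum. *)
Definition route x : queues n :=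
  if all_full b x then x else add_job x [arg min_(k < k0) x k].

Definition next_state p x (c : option 'I_n) : queues n :=
  if c is Some k then remove_job x (p k) else route x.

(* One explicit Euler step of length h for the generator of the process in
   which the servers are assigned to the buffers by p. *)
Definition euler (h : R) p g x : R :=
  (1 - h * \sum_c r c) * g x + h * \sum_c r c * g (next_state p x c).

Definition departure_term p g x : R :=
  \sum_k r (Some k) * g (remove_job x (p k)).

(** The departure term is the only part of an Euler step that depends on the assignment, so
    minimizing it, state by state, minimizes the whole step. *)
Definition best_assignment g x : {perm 'I_n} :=
  [arg min_(p < (1%g : {perm 'I_n})) departure_term p g x]%O.

Definition best_euler (h : R) g x : R := euler h (best_assignment g x) g x.

Hypothesis r_ge0 : forall c, 0 <= r c.

Lemma route_arrival x : exists k, arrival b x k (route x).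
Proof.
exists [arg min_(k < k0) x k]; rewrite /arrival /route; case: (all_full b x) => //.
split => //; apply/forallP => k; case: arg_minnP => // i _; exact.
Qed.

Lemma fits_route x : fits b x -> fits b (route x).
Proof. by move=> xb; have [k /(fits_arrival xb)] := route_arrival x. Qed.

Lemma eulerE h p g x : euler h p g x = (1 - h * \sum_c r c) * g x +
  h * (r None * g (route x) + departure_term p g x).
Proof. by rewrite /euler (big_option (fun c => r c * _)). Qed.

Lemma best_euler_le h p g x : 0 <= h -> best_euler h g x <= euler h p g x.
Proof.
move=> h0; rewrite /best_euler !eulerE lerD2l ler_wpM2l // lerD2l.
by rewrite /best_assignment; case: arg_minP => // q _; exact.
Qed.

(** For such [h] the Euler step is a convex combination of values of [g]. *)
Lemma euler_itv h p g x : 0 <= h -> h * \sum_c r c <= 1 ->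
  (forall y, 0 <= g y <= 1) -> 0 <= euler h p g x <= 1.
Proof.
move=> h0 h1 g01; have g0 y : 0 <= g y by have /andP[] := g01 y.
have g1 y : g y <= 1 by have /andP[] := g01 y.
have W0 : 0 <= \sum_c r c * g (next_state p x c).
  by apply: sumr_ge0 => c _; rewrite mulr_ge0.
have W1 : \sum_c r c * g (next_state p x c) <= \sum_c r c.
  by apply: ler_sum => c _; rewrite ler_piMr.
rewrite /euler; apply/andP; split.
  by rewrite addr_ge0 // mulr_ge0 // subr_ge0.
have : h * \sum_c r c * g (next_state p x c) <= h * \sum_c r c.
  by rewrite ler_wpM2l.
have : (1 - h * \sum_c r c) * g x <= (1 - h * \sum_c r c) * 1.
  by rewrite ler_wpM2l // subr_ge0.
by lra.
Qed.

(** The order stays abstract: [tail_le] will serve for FSL and [tail_ge] for SSL. *)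
Variable le : queues n -> queues n -> Prop.
Hypothesis le_refl : forall x, le x x.
Hypothesis le_arrival : forall x y k k' x' y', fits b x -> fits b y ->
  le x y -> arrival b x k x' -> arrival b y k' y' -> le x' y'.
Hypothesis le_removal : forall x y, le x y -> exists s : {perm 'I_n},
  forall k, le (remove_job x (s k)) (remove_job y k).

Definition load_monotone g : Prop :=
  forall x y, fits b x -> fits b y -> le x y -> g x <= g y.

(** Applied to [x] and itself, [le_arrival] puts the two outcomes below each other. *)
Lemma arrival_route g x k x' : load_monotone g -> fits b x ->
  arrival b x k x' -> g x' = g (route x).
Proof.
move=> gm xb ax; have [k' ar] := route_arrival x.
have x'b := fits_arrival xb ax; have rb := fits_route xb.
by apply/le_anti/andP; split; apply: gm => //;
  [exact: le_arrival (le_refl x) ax ar|exact: le_arrival (le_refl x) ar ax].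
Qed.

Lemma best_euler_monotone h g : 0 <= h -> h * \sum_c r c <= 1 ->
  load_monotone g -> load_monotone (best_euler h g).
Proof.
move=> h0 h1 gm x y xb yb xy; have [s sP] := le_removal xy.
(* At [x] the optimum is bounded by the optimal assignment for [y], carried over by the coupling
   [s]; then the steps compare term by term. *)
apply: le_trans (best_euler_le (best_assignment g y * s)%g g x h0) _.
rewrite /best_euler !eulerE lerD //.
  by rewrite ler_wpM2l ?subr_ge0 //; exact: gm.
rewrite ler_wpM2l // lerD //.
  rewrite ler_wpM2l //; apply: gm; try exact: fits_route.
  have [[k ax] [k' ay]] := (route_arrival x, route_arrival y).
  exact: le_arrival xy ax ay.
apply: ler_sum => k _; rewrite ler_wpM2l // permM; apply: gm.
- exact: fits_remove.
- exact: fits_remove.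
- exact: sP.
Qed.

(** Under the rule, rates and values of [g] after a departure are oppositely ordered, so
    [rearrangement] makes [p] optimal. *)
Lemma euler_le_best h p g x : 0 <= h -> load_monotone g -> fits b x ->
  (forall k k', r (Some k) < r (Some k') ->
    le (remove_job x (p k')) (remove_job x (p k))) ->
  euler h p g x <= best_euler h g x.
Proof.
move=> h0 gm xb rule; rewrite /best_euler !eulerE lerD2l ler_wpM2l // lerD2l.
set q := best_assignment g x.
have anti k l : r (Some k) < r (Some l) ->
    g (remove_job x (p l)) <= g (remove_job x (p k)).
  by move=> /rule kl; apply: gm => //; exact: fits_remove.
(* Permuting by [q * p^-1] turns the assignment [p] into [q]. *)
have := rearrangement (q * p^-1)%g anti; rewrite /departure_term.
by under [X in _ <= X -> _]eq_bigr do rewrite permM permKV.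
Qed.

End euler_operator.

(** The upper bound passes through [(1 + u)^-1] and uses
    [(1 + u) * (1 - u + u ^+ 2) = 1 + u ^+ 3]. *)
Lemma expRN_bounds (R : realType) (u : R) : 0 <= u ->
  1 - u <= expR (- u) <= 1 - u + u ^+ 2.
Proof.
move=> u0; apply/andP; split; first exact: expR_ge1Dx.
have u1 : 0 < 1 + u by lra.
rewrite expRN; apply: (@le_trans _ _ (1 + u)^-1).
  by rewrite lef_pV2 ?posrE ?expR_gt0 // expR_ge1Dx.
rewrite -(ler_pM2l u1) mulfV ?gt_eqF //.
have : 0 <= u ^+ 3 by rewrite exprn_ge0.
by rewrite exprS; nra.
Qed.

(** * The true evolution over a short step against the Euler step *)

Section one_step.
Context {R : realType} {d : measure_display} {Omega : measurableType d}.
Variable P : probability Omega R.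
Context {n : nat}.
Variables (b : option nat) (k0 : 'I_n) (r : option 'I_n -> R).
Variables (F : R -> set (set Omega)) (N : option 'I_n -> R -> Omega -> nat).
Variables (sigma : R -> Omega -> {perm 'I_n}) (X : R -> Omega -> queues n).
Hypothesis r_gt0 : forall c, 0 < r c.
Hypothesis F_filtration : filtration F.
Hypothesis N_poisson : poisson_processes P F r N.
Hypothesis X_adapted : adapted F X.
Hypothesis sigma_adapted : adapted F sigma.
Hypothesis X_path : forall w, decoupled_path b (fun c t => N c t w)
                  (fun t => sigma t w) (fun t => X t w).

Lemma state_adapted : adapted F (fun s w => (X s w, sigma s w)).
Proof.
move=> s [x p] s0; have [Fs _ _] := F_filtration.
have -> : [set w | (X s w, sigma s w) = (x, p)] =
    [set w | X s w = x] `&` [set w | sigma s w = p].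
  by apply/seteqP; split => w /= [-> ->].
by apply: sigma_algebraI; [exact: Fs|exact: X_adapted|exact: sigma_adapted].
Qed.

Lemma integrable_state s (f : queues n -> {perm 'I_n} -> R) : 0 <= s ->
  (forall x p, 0 <= f x p <= 1) ->
  P.-integrable setT (EFin \o (fun w => f (X s w) (sigma s w))).
Proof.
move=> s0 f01; have [_ Fm _] := F_filtration.
apply: (@integrable_discrete _ _ _ _ _ (fun w => (X s w, sigma s w))
          (fun y => f y.1 y.2) 1).
  by move=> y; apply: (Fm s s0); exact: state_adapted.
by move=> [x p]; have /andP[f0 f1] := f01 x p; rewrite ger0_norm.
Qed.

(** The ring pattern is independent of the state and assignment at [s], and with at most one ring
    these determine [g] at [s + h]. With [L] the expected number of rings, the factor 2 adds one
    [L ^+ 2] for replacing [expR (- L)] by [1 - L] and one for the probability of several rings. *)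
Lemma one_step_estimate s h (g : queues n -> R) : 0 <= s -> 0 < h ->
  (forall x, 0 <= g x <= 1) ->
  (forall x k x', fits b x -> arrival b x k x' -> g x' = g (route b k0 x)) ->
  `|\int[P]_w g (X (s + h) w) - \int[P]_w euler b k0 r h (sigma s w) g (X s w)|
    <= 2 * (h * \sum_c r c) ^+ 2.
Proof.
move=> s0 h0 g01 groute.
have st : s < s + h by rewrite ltrDl.
have t0 : 0 <= s + h := le_trans s0 (ltW st).
have [Fs Fm _] := F_filtration.
pose Z w := (X s w, sigma s w).
have mZ y : measurable [set w | Z w = y].
  by apply: (Fm s s0); exact: state_adapted.
pose phi (a : option (option 'I_n)) (y : queues n * {perm 'I_n}) : R :=
  if a is Some c then g (next_state b k0 y.2 y.1 c) else g y.1.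
have phi01 a y : 0 <= phi a y <= 1 by case: a => [c|] /=; exact: g01.
pose E a := ring_event N s (s + h) a.
(* The path lemmas give the new state; [groute] replaces whichever shortest buffer was chosen by
   [route]. *)
have VE a w : E a w -> g (X (s + h) w) = phi a (Z w).
  have [Ncount _ _ _] := N_poisson.
  move=> Ea; case: a Ea => [c|] Ea.
    have := @decoupled_path_one_ring _ _ _ _ _ _ (fun c => Ncount c w)
              (X_path w) s (s + h) c s0 (ltW st) Ea.
    case: c {Ea} => [k /= -> //|[k /groute]]; apply.
    by have [_ _ Xb _] := X_path w; exact: Xb.
  congr g; apply: (decoupled_path_no_ring (fun c => Ncount c w) (X_path w) s0).
    exact: ltW.
  by move=> c; rewrite Ea addn0.
have indep a B : P (Z @^-1` B `&` E a) = (P (Z @^-1` B) * P (E a))%E.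
  apply: (ring_event_indep F_filtration N_poisson _ s0 st).
  refine (@sigma_algebra_countable_preimage _ (queues n * {perm 'I_n})%type (F s) Z B
            (Fs s s0) (fun y => state_adapted y s0)).
have mE a : measurable (E a).
  exact: (measurable_ring_event F_filtration N_poisson).
have intV : P.-integrable setT (EFin \o (fun w => g (X (s + h) w))).
  exact: (integrable_state (f := fun x _ => g x)).
have := Rintegral_partition_bounds mZ mE (@ring_event_inj _ _ _ _ N s (s + h))
  phi01 indep intV (fun w => g01 _) VE.
set L := h * \sum_c r c.
have L0 : 0 <= L by rewrite mulr_ge0 ?(ltW h0) // sumr_ge0 // => c _; exact: ltW.
have PE a : fine (P (E a)) = (if a is Some c then r c * h else 1) * expR (- L).
  rewrite /E (ring_event_prob F_filtration N_poisson r_gt0 _ s0 st) /=.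
  by rewrite [s + h - s]addrAC subrr add0r.
pose e a := \int[P]_w phi a (Z w).
have int_phi a : P.-integrable setT (EFin \o (fun w => phi a (Z w))).
  exact: (integrable_state (f := fun x p => phi a (x, p)) s0).
have e01 a : 0 <= e a <= 1 by apply: Rintegral_bounds.
pose W := \sum_c r c * e (Some c).
have SE : \sum_a fine (P (E a)) * \int[P]_w phi a (Z w) =
    expR (- L) * (e None + h * W).
  rewrite (big_option (fun a => fine (P (E a)) * e a)) PE mul1r mulrDr.
  congr (_ + _); rewrite /W !mulr_sumr; apply: eq_bigr => c _.
  by rewrite PE; ring.
have QE : \sum_a fine (P (E a)) = expR (- L) * (1 + L).
  rewrite (big_option (fun a => fine (P (E a)))) PE mul1r mulrDr mulr1.
  congr (_ + _); under eq_bigr do rewrite PE.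
  rewrite -mulr_suml mulrC; congr (_ * _); rewrite /L mulr_sumr.
  by apply: eq_bigr => c _; rewrite mulrC.
have -> : \int[P]_w euler b k0 r h (sigma s w) g (X s w) =
    (1 - L) * e None + h * W.
  rewrite /euler -/L.
  have intZ c a : P.-integrable setT (EFin \o (fun w => c * phi a (Z w))).
    exact: (integrableZl measurableT c (int_phi a)).
  rewrite (_ : (fun w => _) = (fun w => (1 - L) * phi None (Z w) +
      \sum_c (h * r c) * phi (Some c) (Z w))); last first.
    apply/funext => w; congr (_ + _).
    by rewrite mulr_sumr; apply: eq_bigr => c _; rewrite mulrA.
  rewrite RintegralD //; last exact: Rintegrable_sum.
  rewrite RintegralZl // Rintegral_sum //; congr (_ + _).
  rewrite /W mulr_sumr; apply: eq_bigr => c _.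
  by rewrite RintegralZl // mulrA.
rewrite SE QE; set V := (\int[P]_w g _).
have hW0 : 0 <= h * W.
  rewrite mulr_ge0 ?(ltW h0) // sumr_ge0 // => c _; rewrite mulr_ge0 ?(ltW (r_gt0 _)) //.
  by have /andP[] := e01 (Some c).
have hWL : h * W <= L.
  rewrite /L ler_wpM2l ?(ltW h0) //; apply: ler_sum => c _.
  by rewrite ler_piMr ?(ltW (r_gt0 _)) //; have /andP[] := e01 (Some c).
have /andP[e0 e1] := e01 None.
have /andP[x0 x1] := expRN_bounds L0.
have x2 : expR (- L) <= 1 by rewrite -expR0 ler_expR; lra.
(* From here [x] is [expR (- L)], while [z] and [y] are the contributions of no ring and of one ring
   before damping by [x]. [a1] to [a4] estimate the damping, [a5] the missed probability. *)
move: (h * W) (e None) (expR (- L)) V hW0 hWL e0 e1 x0 x1 x2 => y z x V.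
move=> y0 yL z0 z1 x0 x1 x2 /andP[V0 V1].
have a1 : (1 - L) * z <= x * z by rewrite ler_wpM2r.
have a2 : x * z <= (1 - L) * z + L ^+ 2.
  have : x * z <= (1 - L + L ^+ 2) * z by rewrite ler_wpM2r.
  have : L ^+ 2 * z <= L ^+ 2 by rewrite ler_piMr // sqr_ge0.
  by lra.
have a3 : x * y <= y by rewrite ler_piMl.
have a4 : y - L ^+ 2 <= x * y.
  have : (1 - L) * y <= x * y by rewrite ler_wpM2r.
  have : L * y <= L * L by rewrite ler_wpM2l.
  by rewrite expr2; lra.
have a5 : 1 - L ^+ 2 <= x * (1 + L).
  have : (1 - L) * (1 + L) <= x * (1 + L) by rewrite ler_wpM2r // addr_ge0.
  by rewrite expr2; lra.
by rewrite ler_norml; apply/andP; split; lra.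
Qed.

End one_step.

Lemma tail_sum_split (n : nat) (x : queues n) i m :
  tail_sum x i = (\sum_(i <= j < i + m) occupancy x j + tail_sum x (i + m))%N.
Proof.
elim: m => [|m IH]; first by rewrite addn0 big_geq.
by rewrite IH addnS big_nat_recr ?leq_addr //= (tail_sum_recl x (i + m)) addnA.
Qed.

(** The series stops at the longest buffer, so it is a finite sum. *)
Lemma tail_occupancyE (R : realType) (n : nat) (x : queues n) i :
  tail_occupancy x i = (tail_sum x i)%:R%:E :> \bar R.
Proof.
pose m := (\max_k x k).+1.
have xm k : (x k < m)%N by rewrite ltnS; exact: leq_bigmax.
have occ0 j : (i + m <= j)%N -> occupancy x j = 0%N.
  move=> mj; rewrite occupancy_sum big1 // => k _; apply/eqP.
  by rewrite eqb0 -ltnNge (leq_trans (xm k)) // (leq_trans _ mj) // leq_addl.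
rewrite /tail_occupancy (nneseries_split _ m); last by move=> j _; rewrite lee_fin.
rewrite eseries0 ?adde0; last by move=> j /occ0 ->.
rewrite sumEFin -natr_sum (tail_sum_split x i m) tail_sum_eq0 ?addn0 // => k.
by rewrite (leq_trans (xm k)) // leq_addl.
Qed.

(** * Comparison of two systems by iterated Euler steps *)

Section comparison.
Context {R : realType} {d : measure_display} {Omega : measurableType d}.
Variable P : probability Omega R.
Context {n : nat}.
Variables (b : option nat) (lam : R) (mu : 'I_n -> R) (A : R -> Omega -> nat).
Hypothesis n_gt0 : (0 < n)%N.
Hypothesis lam_gt0 : 0 < lam.
Hypothesis mu_gt0 : forall k, 0 < mu k.
Variable le : queues n -> queues n -> Prop.
Hypothesis le_refl : forall x, le x x.
Hypothesis le_arrival : forall x y k k' x' y', fits b x -> fits b y ->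
  le x y -> arrival b x k x' -> arrival b y k' y' -> le x' y'.
Hypothesis le_removal : forall x y, le x y -> exists s : {perm 'I_n},
  forall k, le (remove_job x (s k)) (remove_job y k).

Lemma integrable_system rule X t (g : queues n -> R) :
  decoupled_system P b lam mu A rule X -> 0 <= t ->
  (forall x, 0 <= g x <= 1) ->
  P.-integrable setT (EFin \o (fun w => g (X t w))).
Proof.
move=> [F [S [sigma [Ff _ [Xad sad] _ _]]]] t0 g01.
exact: (integrable_state P Ff Xad sad (f := fun x _ => g x)).
Qed.

(** [X] follows any assignment and [Y] an optimal one. Each step passes from [Y] to the optimal
    operator, compares at the earlier time, and returns to [X]; only expectations are compared, so
    the two systems may have unrelated service clocks and filtrations. *)
Lemma decoupled_system_le rule rule' X Y t (g : queues n -> R) :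
  decoupled_system P b lam mu A rule X ->
  decoupled_system P b lam mu A rule' Y ->
  (forall p x, rule' p x -> forall k k', mu k < mu k' ->
    le (remove_job x (p k')) (remove_job x (p k))) ->
  (forall w, le (Y 0 w) (X 0 w)) -> 0 <= t ->
  (forall x, 0 <= g x <= 1) -> load_monotone b le g ->
  \int[P]_w g (Y t w) <= \int[P]_w g (X t w).
Proof.
move=> sysX sysY rule'P YX0 t0 g01 gm.
have intX := fun s g => @integrable_system _ _ s g sysX.
have intY := fun s g => @integrable_system _ _ s g sysY.
have [FX [SX [sX [FXf XN [Xad sXad] Xpath _]]]] := sysX.
have [FY [SY [sY [FYf YN [Yad sYad] Ypath Yrule]]]] := sysY.
pose k0 := Ordinal n_gt0.
pose r := clocks (n%:R * lam) mu.
have r_gt0 c : 0 < r c.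
  by case: c => [k|] /=; [exact: mu_gt0|rewrite mulr_gt0 // ltr0n].
have r_ge0 c := ltW (r_gt0 c).
have Xfits s w : 0 <= s -> fits b (X s w) by have [_ _ + _] := Xpath w; apply.
have Yfits s w : 0 <= s -> fits b (Y s w) by have [_ _ + _] := Ypath w; apply.
set L := \sum_c r c.
have L0 : 0 <= L by rewrite sumr_ge0.
(* The function [f] is quantified after [m], since the induction hypothesis is applied to
   [best_euler] of [f]. The factor 4 is the one-step error 2 for each system. *)
have steps h m : 0 < h -> h * L <= 1 -> forall f : queues n -> R,
    (forall x, 0 <= f x <= 1) -> load_monotone b le f ->
    \int[P]_w f (Y (m%:R * h) w) <=
    \int[P]_w f (X (m%:R * h) w) + m%:R * (4 * (h * L) ^+ 2).
  move=> h0 hL; elim: m => [|m IH] f f01 fm.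
    rewrite !mul0r addr0; apply: le_Rintegral => //; try exact: intX; try exact: intY.
    by move=> w _; apply: fm; [exact: Yfits|exact: Xfits|exact: YX0].
  pose s := m%:R * h; have s0 : 0 <= s by rewrite mulr_ge0 // ltW.
  have -> : m.+1%:R * h = s + h by rewrite /s -natr1 mulrDl mul1r.
  have h0' := ltW h0.
  have froute x k x' : fits b x -> arrival b x k x' -> f x' = f (route b k0 x).
    exact: (arrival_route k0 le_refl le_arrival fm).
  have := one_step_estimate r_gt0 FXf XN Xad sXad Xpath s0 h0 f01 froute.
  have := one_step_estimate r_gt0 FYf YN Yad sYad Ypath s0 h0 f01 froute.
  rewrite -/L.
  pose T := best_euler b k0 r h f.
  have T01 x : 0 <= T x <= 1 by exact: euler_itv.
  have Tm : load_monotone b le T.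
    exact: (best_euler_monotone k0 r_ge0 le_arrival le_removal h0' hL fm).
  have IHT := IH T T01 Tm.
  have euler01 p x := euler_itv b k0 r_ge0 p x h0' hL f01.
  have eY : \int[P]_w euler b k0 r h (sY s w) f (Y s w) <= \int[P]_w T (Y s w).
    apply: le_Rintegral => //; last 2 first.
    - exact: intY.
    - move=> w _; apply: (euler_le_best k0 h0' fm); first exact: Yfits.
      exact: rule'P (Yrule s w s0).
    exact: (integrable_state P FYf Yad sYad (f := fun x p => euler b k0 r h p f x)).
  have eX : \int[P]_w T (X s w) <= \int[P]_w euler b k0 r h (sX s w) f (X s w).
    apply: le_Rintegral => //; first exact: intX.
      exact: (integrable_state P FXf Xad sXad (f := fun x p => euler b k0 r h p f x)).
    by move=> w _; exact: best_euler_le.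
  move: IHT; rewrite -/s -natr1 mulrDl mul1r !ler_norml => IHT.
  by move=> /andP[_ h1] /andP[h2 _]; lra.
(* Time 0 is treated apart because the step [t / m] must be positive. *)
move: t0; rewrite le_eqVlt => /predU1P[<-|t0].
  apply: le_Rintegral => //; [exact: intY|exact: intX|].
  by move=> w _; apply: gm; [exact: Yfits|exact: Xfits|exact: YX0].
apply/ler_addgt0Pr => e e0.
(* With [m] above [C], the first summand ensures [h * L <= 1] and the second a total error
   [4 * (t * L) ^+ 2 / m] of at most [e]; the summand 1 keeps [C] positive. *)
pose C := (t * L) + 4 * (t * L) ^+ 2 / e + 1.
have tL0 : 0 <= t * L by rewrite mulr_ge0 // ltW.
have Ce0 : 0 <= 4 * (t * L) ^+ 2 / e.
  by rewrite divr_ge0 ?(ltW e0) // mulr_ge0 // sqr_ge0.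
have C0 : 0 < C by rewrite /C; lra.
have [m Cm] : exists m : nat, C < m%:R.
  by exists (Num.bound C); exact: archi_boundP (ltW C0).
have m0 : 0 < m%:R :> R by exact: lt_trans Cm.
have [tLm Cem] : t * L < m%:R /\ 4 * (t * L) ^+ 2 / e < m%:R.
  by move: Cm tL0 Ce0; rewrite /C; move: (t * L) (_ / e) => u v; lra.
have h0 : 0 < t / m%:R by rewrite divr_gt0.
have hL : t / m%:R * L <= 1.
  by rewrite mulrAC ler_pdivrMr // mul1r ltW.
have := steps (t / m%:R) m h0 hL g g01 gm.
rewrite mulrCA divff ?gt_eqF // mulr1 => /le_trans; apply; rewrite lerD2l.
have -> : m%:R * (4 * (t / m%:R * L) ^+ 2) = 4 * (t * L) ^+ 2 / m%:R.
  by field; rewrite gt_eqF.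
by rewrite ler_pdivrMr // (mulrC e) -ler_pdivrMr // ltW.
Qed.

End comparison.

(** * From expectations to the stochastic order *)

Lemma jsq_system_decoupled (R : realType) (d : measure_display)
    (Omega : measurableType d) (P : probability Omega R) (n : nat)
    (b : option nat) (lam : R) (mu : 'I_n -> R) (A : R -> Omega -> nat)
    (pi : R -> Omega -> 'I_n) (X : R -> Omega -> queues n) :
  jsq_system P b lam mu A pi X ->
  decoupled_system P b lam mu A (fun _ _ => True) X.
Proof.
move=> [F [S [Ff FN Xad Xpath]]]; exists F, S, (fun _ _ => 1%g); split => //.
  split => // t p t0; have [/(_ t t0)[F0 FC _] _ _] := Ff.
  (* Events of the constant identity assignment are the whole space or empty, hence in every
     [F t]. *)
  have [->|p1] := eqVneq 1%g p.
    by have := FC _ F0; rewrite setD0; congr (F t _); apply/seteqP; split.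
  by move: F0; congr (F t _); apply/seteqP; split => w //= /eqP; rewrite (negbTE p1).
by move=> w; exact: jsq_path_decoupled (Xpath w).
Qed.

(** This turns a tail probability into the expectation of a monotone function with values in
    [[0, 1]], the form required by [decoupled_system_le]. *)
Lemma tail_indicator_Rintegral (R : realType) (d : measure_display)
    (Omega : measurableType d) (P : probability Omega R) (n : nat)
    (X : Omega -> queues n) (i : nat) (a : R) :
  (forall x, measurable [set w | X w = x]) ->
  P [set w | (a%:E < tail_occupancy (X w) i)%E] =
  (\int[P]_w (a < (tail_sum (X w) i)%:R)%R%:R)%:E.
Proof.
move=> mX; set B := [set w | _].
have mB : measurable B.
  have -> : B = X @^-1` [set x | (a%:E < tail_occupancy x i)%E] by [].
  exact: (@sigma_algebra_countable_preimage _ (queues n) _ X _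
            (sigma_algebra_measurable Omega)).
have -> : \int[P]_w (a < (tail_sum (X w) i)%:R)%R%:R = \int[P]_w \1_B w.
  congr Rintegral; apply/funext => w; rewrite indicE; congr (nat_of_bool _)%:R.
  by apply/idP/idP => [aw|/set_mem]; rewrite ?inE /B /= tail_occupancyE lte_fin.
rewrite /Rintegral integral_indic // setIT fineK //.
exact: fin_num_measure.
Qed.

Theorem proposition5p1
  (R : realType) (d : measure_display) (Omega : measurableType d)
  (P : probability Omega R)
  (n : nat) (n_gt0 : (0 < n)%N)
  (lam : R) (lam_gt0 : 0 < lam)
  (mu_min mu_max : R) (mu_min_gt0 : 0 < mu_min) (mu_min_max : mu_min < mu_max)
  (mu : 'I_n -> R) (mu_bounds : forall k, mu_min <= mu k <= mu_max)
  (b : option nat) (b_ge1 : capacity_ge1 b)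
  (A : R -> Omega -> nat)
  (pi : R -> Omega -> 'I_n)
  (X XFSL XSSL : R -> Omega -> queues n)
  (X_jsq : jsq_system P b lam mu A pi X)
  (X_fsl : jsq_fsl_system P b lam mu A XFSL)
  (X_ssl : jsq_ssl_system P b lam mu A XSSL)
  (init_fsl : forall i w, occupancy (XFSL 0 w) i = occupancy (X 0 w) i)
  (init_ssl : forall i w, occupancy (XSSL 0 w) i = occupancy (X 0 w) i) :
  forall (t : R) (i : nat), 0 <= t ->
    st_le P P (fun w => tail_occupancy (XFSL t w) i)
              (fun w => tail_occupancy (X t w) i) /\
    st_le P P (fun w => tail_occupancy (X t w) i)
              (fun w => tail_occupancy (XSSL t w) i).
Proof.
move=> t i t0.
have mu_gt0 k : 0 < mu k.
  by have /andP[muk _] := mu_bounds k; exact: lt_le_trans muk.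
have X_dec := jsq_system_decoupled X_jsq.
have meas rule Y : decoupled_system P b lam mu A rule Y ->
    forall x, measurable [set w | Y t w = x].
  move=> [F [S [sigma [[_ Fm _] _ [Yad _] _ _]]]] x.
  by apply: (Fm t t0); exact: Yad.
have bool01 (c : bool) : 0 <= (c%:R : R) <= 1.
  by case: c; rewrite ?ler01 ?lexx.
split => a.
  rewrite (tail_indicator_Rintegral _ _ _ (meas _ _ X_fsl)).
  rewrite (tail_indicator_Rintegral _ _ _ (meas _ _ X_dec)) lee_fin.
  apply: (@decoupled_system_le _ _ _ _ _ _ _ _ _ n_gt0 lam_gt0 mu_gt0 tail_le
    (@tail_le_refl n) (@arrival_tail_le n b) (@removal_coupling n) _ _ _ _ _
    (fun x => (a < (tail_sum x i)%:R)%R%:R) X_dec X_fsl) => //.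
  - by move=> p x fsl k k' /fsl/tail_le_remove.
  - by move=> w; apply: tail_le_of_occupancy => j; exact: init_fsl.
  - move=> x y _ _ xy; rewrite ler_nat; case: ltP => // ax.
    by rewrite (lt_le_trans ax) // ler_nat; exact: xy.
rewrite (tail_indicator_Rintegral _ _ _ (meas _ _ X_ssl)).
rewrite (tail_indicator_Rintegral _ _ _ (meas _ _ X_dec)) lee_fin.
(* For the reversed order the monotone function is [1 - f], so the comparison is made on complements
   and then turned around. *)
pose f (x : queues n) : R := (a < (tail_sum x i)%:R)%R%:R.
have compl rule Y : decoupled_system P b lam mu A rule Y ->
    \int[P]_w (1 - f (Y t w)) = 1 - \int[P]_w f (Y t w).
  move=> sysY; rewrite RintegralB //.
  - by rewrite Rintegral_cst_prob.
  - exact: finite_measure_integrable_cst.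
  - by apply: (integrable_system (g := f) sysY t0) => x; exact: bool01.
rewrite -[leLHS]/(\int[P]_w f (X t w)) -[leRHS]/(\int[P]_w f (XSSL t w)).
rewrite -lerN2 -(lerD2l 1) -(compl _ _ X_ssl) -(compl _ _ X_dec).
apply: (@decoupled_system_le _ _ _ _ _ _ _ _ _ n_gt0 lam_gt0 mu_gt0 tail_ge
  (@tail_le_refl n) _ _ _ _ _ _ _ (fun x => 1 - f x) X_dec X_ssl) => //.
- by move=> x y k k' x' y' xb yb xy ax ay; exact: arrival_tail_le xy ay ax.
- move=> x y /removal_coupling[s sP]; exists s^-1%g => k.
  by have := sP (s^-1 k)%g; rewrite permKV.
- by move=> p x ssl k k' /ssl/tail_le_remove.
- by move=> w; apply: tail_le_of_occupancy => j; rewrite init_ssl.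
- move=> x; have := bool01 (a < (tail_sum x i)%:R); rewrite /f => /andP[c0 c1].
  by apply/andP; split; lra.
- move=> x y _ _ xy; rewrite lerD2l lerN2 ler_nat; case: ltP => // ay.
  by rewrite (lt_le_trans ay) // ler_nat; exact: xy.
Qed.
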